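(* Consider the wind turbine rotor error dynamics described in the context, with the high-level control law $$\widetilde{\boldsymbol{\theta}}=-\boldsymbol{\rho}_0\,\mathrm{sat}\left(k\sigma,-\theta_0,\overline{\theta}-\theta_0\right),$$ where $k>0$ is the control gain, and let $\gamma>0$ be given. If the control gain is chosen such that $$k\ \geq\ \frac{1}{\mu\varphi}\left(1+\frac{\left(\bar{\rho}_\omega+2\psi\right)^2}{4\psi}+\frac{\bar{\rho}_{\nu}^2}{4\gamma^2}\right),$$ then the corresponding closed-loop error dynamics $$\dot{\sigma}=\left(\rho_{\omega}+\psi\right)\left(\sigma-\psi\widetilde{\omega}_{rI}\right)+\rho_{\nu}\widetilde{\nu}-\boldsymbol{\rho}_{\theta}^\top\boldsymbol{\rho}_0\,\mathrm{sat}\left(k\sigma,-\theta_0,\overline{\theta}-\theta_0\right)$$ is $\mathcal{L}_2$-gain stable, and the $\mathcal{L}_2$-gain from the exogenous signal $\widetilde{\nu}$ to the regulated error $\widetilde{\omega}_r$ is upper bounded by $\gamma$.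
   Context: Notation. $\mathcal{L}_{2e}$ is the extended space of measurable functions on $[0,\infty)$ whose truncation (equal to the function on $[0,T)$ and to zero for $t\ge T$) is square integrable for every $T\in[0,\infty)$. For $a\le b$, $\mathrm{sat}(y,a,b)$ is the saturation function, equal to $a$ if $y<a$, to $y$ if $a\le y\le b$, and to $b$ if $y>b$. The constant $\mu$. It is the constant of the following property of the saturation function: for $r>0$ there exists $\mu>0$ such that $y\,\mathrm{sat}(y,y_1,y_2)\ge\mu y^2$ for all $y$ in the ball $\{|y|\le r\}$; it is used with $y=k\sigma$, $y_1=-\theta_0$, $y_2=\overline\theta-\theta_0$. Finite-gain stability. A system $\dot{\mathbf z}=g(\mathbf z,\mathbf u)$, $\mathbf y=h(\mathbf z)$ with input $\mathbf u$ and output $\mathbf y$ is $\gamma$-dissipative, which indicates finite-gain $\mathcal{L}_2$ stability with gain at most $\gamma$, if there is an energy function $V(\mathbf z)\ge 0$ with $V(\mathbf z(t_1))\le V(\mathbf z(t_0))+\int_{t_0}^{t_1}(\gamma^2\|\mathbf u\|^2-\|\mathbf y\|^2)\,d\tau$ for all $t_1\ge t_0$ and all inputs $\mathbf u\in\mathcal{L}_{2e}$. Rotor model. The rotor speed $\omega_r\in\mathcal{L}_{2e}$ obeys $\dot\omega_r=f(\nu,\omega_r,\boldsymbol\theta)$, where $\nu\in\mathcal{L}_{2e}$ is the wind disturbance, $\boldsymbol\theta\in\mathbb{R}^3$ is the vector of pitch angles $\theta_j$, $j=1,2,3$, with $0\le\theta_j\le\overline\theta$ ($\overline\theta$ the maximum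 allowable pitch angle), and $$f(\nu,\omega_r,\boldsymbol\theta)=g_1(\nu,\omega_r)-g_2(\nu,\omega_r)\|\boldsymbol\theta\|^2,$$ $$g_1=\frac{\kappa\nu^3}{J\omega_r}\left(\frac{\nu}{\omega_r}-p_1\right)e^{-p_2\nu/\omega_r}-\frac{P_0}{J\omega_r},\qquad g_2=\frac{\kappa\nu^3}{3J\omega_r}p_3e^{-p_2\nu/\omega_r},$$ with positive constants $\kappa,p_1,p_2,p_3$, rated mechanical power $P_0$ and total drive-train inertia $J$. Errors. $(\nu_0,\omega_{r0},\boldsymbol\theta_0)$ is a known operating point with $f(\nu_0,\omega_{r0},\boldsymbol\theta_0)=0$; $\theta_0$ denotes the (scalar) operating pitch angle. Put $\widetilde\omega_r=\omega_r-\omega_{r0}$, $\widetilde\nu=\nu-\nu_0$, $\widetilde{\boldsymbol\theta}=\boldsymbol\theta-\boldsymbol\theta_0$, $\widetilde\omega_{rI}(t)=\int_0^t\widetilde\omega_r\,d\tau$, and $\sigma=\widetilde\omega_r+\psi\widetilde\omega_{rI}$ with $\psi>0$, so that $\dot{\widetilde\omega}_{rI}=\widetilde\omega_r=\sigma-\psi\widetilde\omega_{rI}$. The disturbance $\widetilde\nu$ ranges over $\mathcal{L}_{2e}$. By the mean value theorem, $$\dot\sigma=\rho_\nu\widetilde\nu+(\rho_\omega+\psi)\widetilde\omega_r+\boldsymbol\rho_\theta^\top\widetilde{\boldsymbol\theta},$$ where $\rho_\nu=\partial f/\partial\nu$, $\rho_\omega=\partial f/\partial\omega_r$, $\boldsymbol\rho_\theta=\nabla_{\boldsymbol\theta}f$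 are evaluated at the intermediate point $(\eta_\nu,\eta_\omega,\boldsymbol\eta_\theta)=\lambda(\nu_0,\omega_{r0},\boldsymbol\theta_0)+(1-\lambda)(\nu,\omega_r,\boldsymbol\theta)$ for some $\lambda\in(0,1)$. Standing assumption. The dynamics is sufficiently smooth, so that $|\rho_\nu|\le\bar\rho_\nu$ and $|\rho_\omega|\le\bar\rho_\omega$ with positive constants $\bar\rho_\nu,\bar\rho_\omega$; moreover there exist $\boldsymbol\rho_0\in\mathbb{R}^3$ and a positive constant $\varphi$ such that $\boldsymbol\rho_\theta^\top\boldsymbol\rho_0\ge\varphi$. The vector $\boldsymbol\rho_0$ in the control law is one satisfying this condition.
   Formalization: The dissipation inequality is stated for motions that stay where the coefficient bounds hold (an arbitrary operating region with positive rotor speed) and in the ball |kσ| ≤ r on which μ is valid; for all inputs and states the bounds are inconsistent and stability fails under saturation. *)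

(* Defs.v *)
From HB Require Import structures.
From mathcomp Require Import all_boot all_order all_algebra.
From mathcomp Require Import all_classical all_reals all_analysis.
Import Order.TTheory GRing.Theory Num.Theory.
Import numFieldNormedType.Exports.

Set Implicit Arguments.
Unset Strict Implicit.
Unset Printing Implicit Defensive.

Local Open Scope classical_set_scope.
Local Open Scope ring_scope.

Section Dissipativity.
Variable R : realType.

(* Square integrability of the truncation, for every horizon T. *)
Definition L2e (u : R -> R) : Prop :=
  measurable_fun (`[0, +oo[%classic : set R) u /\
  forall T : R, 0 <= T ->
    (@lebesgue_measure R).-integrable `[0, +oo[%classic
      (fun t => (((u \_ `[0, T[%classic) t) ^+ 2)%:E).

(* Caratheodory solution on [a, b] of a planar system z' = g(z, u): an input of
   class L2e is only measurable, so the equation is taken in integral form. *)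
Definition solution (g : R * R -> R -> R * R) (u : R -> R) (z : R -> R * R)
    (a b : R) : Prop :=
  [/\ (@lebesgue_measure R).-integrable `[a, b]%classic
        (fun s => (g (z s) (u s)).1%:E),
      (@lebesgue_measure R).-integrable `[a, b]%classic
        (fun s => (g (z s) (u s)).2%:E),
      (forall t, a <= t <= b ->
        (z t).1 = (z a).1 +
          Rintegral (@lebesgue_measure R) `[a, t]%classic
            (fun s => (g (z s) (u s)).1)) &
      (forall t, a <= t <= b ->
        (z t).2 = (z a).2 +
          Rintegral (@lebesgue_measure R) `[a, t]%classic
            (fun s => (g (z s) (u s)).2))].

(* gamma-dissipativity of z' = g(z, u), y = h(z), i.e. finite-gain L2 stability
   from u to y with gain at most gamma.  X is the set of (state, input) pairs
   on which the system model is valid: motions are considered for as long as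
   they stay in X, and X = (fun _ _ => True) gives the unrestricted notion.
   The storage function V depends on neither the input, the motion nor the
   times.  Restricting a motion defined on [0, +oo) to [t0, t1] shows that it
   is enough to ask for solutions on [t0, t1]. *)
Definition dissipative_on (X : R * R -> R -> Prop)
    (g : R * R -> R -> R * R) (h : R * R -> R) (gamma : R) : Prop :=
  exists V : R * R -> R,
    (forall z, 0 <= V z) /\
    forall (u : R -> R) (z : R -> R * R) (t0 t1 : R),
      0 <= t0 -> t0 <= t1 ->
      L2e u -> solution g u z t0 t1 ->
      {ae (@lebesgue_measure R), forall t, t0 <= t <= t1 -> X (z t) (u t)} ->
      V (z t1) <= V (z t0) +
        Rintegral (@lebesgue_measure R) `[t0, t1]%classic
          (fun s => gamma ^+ 2 * u s ^+ 2 - h (z s) ^+ 2).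

End Dissipativity.

Section Rotor.
Variable R : realType.

Definition sat (y a b : R) : R :=
  if y < a then a else if y <= b then y else b.

(* Euclidean inner product; the library norm on matrices is the sup norm. *)
Definition dotv (n : nat) (v w : 'cV[R]_n) : R := \sum_i v i 0 * w i 0.

Record rotor := Rotor {
  kappa : R; p1 : R; p2 : R; p3 : R;
  P0 : R; (* rated mechanical power *)
  inertia : R;
  kappa_gt0 : 0 < kappa; p1_gt0 : 0 < p1; p2_gt0 : 0 < p2; p3_gt0 : 0 < p3;
  P0_gt0 : 0 < P0; inertia_gt0 : 0 < inertia }.

Definition g1 (c : rotor) (nu om : R) : R :=
  kappa c * nu ^+ 3 / (inertia c * om) * (nu / om - p1 c)
    * expR (- (p2 c * nu / om)) - P0 c / (inertia c * om).

Definition g2 (c : rotor) (nu om : R) : R :=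
  kappa c * nu ^+ 3 / (3 * inertia c * om) * p3 c * expR (- (p2 c * nu / om)).

(* (wind speed, rotor speed, pitch angles) *)
Definition wpoint : Type := (R * R * 'cV[R]_3)%type.

Definition rotor_f (c : rotor) (p : wpoint) : R :=
  g1 c p.1.1 p.1.2 - g2 c p.1.1 p.1.2 * dotv p.2 p.2.

(* The rotor turns and the pitch angles respect their limits. *)
Definition rotor_domain (thbar : R) : set wpoint :=
  [set p : wpoint | 0 < p.1.2 /\ forall j, 0 <= p.2 j 0 <= thbar].

Definition rho_nu (c : rotor) (p : wpoint) : R :=
  derive1 (fun nu : R => rotor_f c (nu, p.1.2, p.2)) p.1.1.

Definition rho_om (c : rotor) (p : wpoint) : R :=
  derive1 (fun om : R => rotor_f c (p.1.1, om, p.2)) p.1.2.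

Definition rho_th (c : rotor) (p : wpoint) : 'cV[R]_3 :=
  \col_j derive1 (fun x : R =>
    rotor_f c (p.1.1, p.1.2, p.2 + x *: delta_mx j 0)) 0.

Definition intermediate (q p : wpoint) (lam : R) : wpoint :=
  (lam * q.1.1 + (1 - lam) * p.1.1,
   lam * q.1.2 + (1 - lam) * p.1.2,
   lam *: q.2 + (1 - lam) *: p.2).

(* lam selects an intermediate point as in the mean value theorem. *)
Definition mean_value (c : rotor) (q p : wpoint) (lam : R) : Prop :=
  0 < lam < 1 /\
  let eta := intermediate q p lam in
  rotor_f c p - rotor_f c q =
    rho_nu c eta * (p.1.1 - q.1.1) + rho_om c eta * (p.1.2 - q.1.2)
    + dotv (rho_th c eta) (p.2 - q.2).

(* Bounds on the coefficients of the error dynamics, uniform over the operating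
   region D.  D is a parameter because the bounds cannot hold for all wind
   speeds: rho_th vanishes when the wind speed does. *)
Definition coefficient_bounds (c : rotor) (q : wpoint) (D : set wpoint)
    (bnu bom phi : R) (rho0 : 'cV[R]_3) : Prop :=
  forall p lam, D p -> mean_value c q p lam ->
    let eta := intermediate q p lam in
    [/\ `|rho_nu c eta| <= bnu,
        `|rho_om c eta| <= bom &
        phi <= dotv (rho_th c eta) rho0].

(* All three blades have the same pitch angle th0 at the operating point. *)
Definition operating_point (nu0 om0 th0 : R) : wpoint :=
  (nu0, om0, const_mx th0).

(* The state of the closed loop is z = (sigma, integral of the speed error),
   its input is the wind error, its output is the speed error. *)
Definition speed_error (psi : R) (z : R * R) : R := z.1 - psi * z.2.

Definition pitch_error (th0 thbar k : R) (rho0 : 'cV[R]_3) (sigma : R) :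
    'cV[R]_3 :=
  - (sat (k * sigma) (- th0) (thbar - th0) *: rho0).

Definition closed_loop_point (nu0 om0 th0 thbar psi k : R) (rho0 : 'cV[R]_3)
    (z : R * R) (u : R) : wpoint :=
  (nu0 + u, om0 + speed_error psi z,
   const_mx th0 + pitch_error th0 thbar k rho0 z.1).

(* sigma' = omega_r' + psi * (speed error), with omega_r' = f. *)
Definition closed_loop (c : rotor) (nu0 om0 th0 thbar psi k : R)
    (rho0 : 'cV[R]_3) (z : R * R) (u : R) : R * R :=
  (rotor_f c (closed_loop_point nu0 om0 th0 thbar psi k rho0 z u)
     + psi * speed_error psi z,
   speed_error psi z).

(* The constant mu in y * sat(y) >= mu * y^2 depends on the radius r of the
   ball of y = k * sigma on which this inequality is used; no such constant
   exists on the whole line. *)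
Definition closed_loop_region (D : set wpoint) (r : R)
    (nu0 om0 th0 thbar psi k : R) (rho0 : 'cV[R]_3)
    (z : R * R) (u : R) : Prop :=
  D (closed_loop_point nu0 om0 th0 thbar psi k rho0 z u) /\ `|k * z.1| <= r.

End Rotor.

(* Main.v *)
Require Import Defs.
From HB Require Import structures.
From mathcomp Require Import all_boot all_order all_algebra.
From mathcomp Require Import all_classical all_reals all_analysis.
From mathcomp Require Import measurable_realfun ring lra.
Import Order.TTheory GRing.Theory Num.Theory.
Import numFieldNormedType.Exports.
Local Open Scope classical_set_scope.
Local Open Scope ring_scope.

(** The storage function is a weighted sum of squares of the two states,
<<
      V (sigma, x) = sigma^2 / 2 + a * x^2 / 2,   a = psi * (bom + psi + 2).
>>
    Put e = sigma - psi * x for the speed error and let u be the wind error.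
    Since psi * (x * e) = sigma * e - e^2, the part of V' that comes from x
    is (1 + b) * (sigma * e - e^2) with b = bom + psi + 1.  It provides the
    required term - e^2, a further - b * e^2, and a multiple of sigma * e.
    The mean value theorem turns the closed loop into
    sigma' = (rho_om + psi) * e + rho_nu * u - (feedback), and the two products
    sigma * e and sigma * u in sigma * sigma' are removed by completing
    squares: the first against b * e^2, at the price of b * sigma^2, the second
    against gamma^2 * u^2, at the price of bnu^2 / (4 gamma^2) * sigma^2.  The
    saturated feedback contributes at least mu * phi * k * sigma^2, and
    b <= 1 + (bom + 2 psi)^2 / (4 psi), so the gain condition pays for both.
    The outcome, [dissipation_inequality], is the pointwise bound
    V' <= gamma^2 * u^2 - e^2.

    The choice b = bom + psi + 1 is what makes the argument work with the
    stated gain: the coefficient (rho_om + psi + 1 + b)^2 / (4 b) of sigma^2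
    left by the first square is smallest there when rho_om = bom.

    It remains to integrate.  Inputs are only measurable, hence the states are
    only primitives of integrable functions, and V along a motion need not be
    differentiable at every time.  The chain rule for V is
    replaced by [sqr_primitive]: if F is a primitive of an integrable f, then
    F(b)^2 - F(a)^2 is twice the integral of F * f.

    The mean value theorem itself needs rotor_f to be differentiable along the
    segment from the operating point ([differentiable_rotor_f]); this holds
    because the rotor speed stays positive on it. *)

Set Implicit Arguments.
Unset Strict Implicit.

(** * The mean value theorem for the rotor model *)

Section MeanValue.
Context {R : realType}.

(** One-variable mean value theorem along the segment: the derivative of
    t |-> f (x + t *: v) is the directional derivative of f. *)
Lemma mean_value_segment (V : normedModType R) (f : V -> R) (x v : V) :
  (forall t : R, 0 <= t <= 1 -> differentiable f (x + t *: v)) ->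
  exists t : R, 0 < t < 1 /\ f (x + v) - f x = 'D_v f (x + t *: v).
Proof.
move=> df.
pose path (t : R) := f (x + t *: v).
have dpath (t : R) : 0 <= t <= 1 -> is_derive t (1 : R) path ('D_v f (x + t *: v)).
  move=> /df dft.
  have dline : is_diff t (fun s : R => x + s *: v) (fun s => s *: v).
    have -> : (fun s : R => s *: v) = 0 + ( *:%R^~ v : R -> V).
      by apply/funext => s; rewrite [RHS]add0r.
    exact: (@is_diffD _ _ _ (cst x)).
  have dcomp : is_diff t path ('d f (x + t *: v) \o (fun s => s *: v)).
    by apply: is_diff_comp; apply: DiffDef.
  apply: DeriveDef; first by apply: diff_derivable.
  by rewrite deriveE// diff_val/= scale1r deriveE.
have [||c c01] := @MVT R path (fun t => 'D_v f (x + t *: v)) 0 1 ltr01.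
- by move=> t; rewrite in_itv/= => /andP[/ltW t0 /ltW t1]; apply: dpath; rewrite t0 t1.
- apply: derivable_within_continuous => t; rewrite in_itv/= => t01.
  by have [] := dpath t t01.
rewrite /path scale1r scale0r addr0 subr0 mulr1 => fE.
by exists c; split => //; move: c01; rewrite in_itv.
Qed.

Lemma differentiable_fst (V W : normedModType R) (x : V * W) : differentiable fst x.
Proof. by apply: (@linear_differentiable _ _ _ fst) => y; exact: cvg_fst. Qed.

Lemma differentiable_snd (V W : normedModType R) (x : V * W) : differentiable snd x.
Proof. by apply: (@linear_differentiable _ _ _ snd) => y; exact: cvg_snd. Qed.

(** The formula for [rotor_f] is regrouped as sums and products of functions of
    the whole point, so that the rules for differentiation apply.  The type
    [wpoint R] is written as a product because it is there that the normed
    module structure is found. *)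
Lemma differentiable_rotor_f (c : rotor R) (p : wpoint R) :
  p.1.2 != 0 -> differentiable (rotor_f c : R * R * 'cV[R]_3 -> R) p.
Proof.
move=> p0.
pose N (q : R * R * 'cV[R]_3) : R := q.1.1.
pose W (q : R * R * 'cV[R]_3) : R := q.1.2.
pose S (q : R * R * 'cV[R]_3) : R := \sum_i (q.2 i 0) ^+ 2.
have dN : differentiable N p.
  apply: (@differentiable_comp _ _ _ _ fst fst); exact: differentiable_fst.
have dW : differentiable W p.
  apply: (@differentiable_comp _ _ _ _ fst snd).
    exact: differentiable_fst.
  exact: differentiable_snd.
have dS : differentiable S p.
  rewrite (_ : S = \sum_i (fun q : R * R * 'cV[R]_3 => q.2 i 0) ^+ 2); last first.
    apply/funext => q; rewrite fct_sumE; apply: eq_bigr => i _.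
    by rewrite fctE.
  apply: differentiable_sum => i; apply: differentiableX.
  apply: (@differentiable_comp _ _ _ _ snd (fun M : 'cV[R]_3 => M i 0)).
    exact: differentiable_snd.
  exact: differentiable_coord.
have dV (a : R) : a != 0 -> differentiable (fun q => (a * W q)^-1) p.
  by move=> a0; apply: differentiableV; rewrite ?mulf_neq0//; apply: differentiableM.
pose Q := N * (fun q => (1 * W q)^-1).
have dQ : differentiable Q p by apply: differentiableM => //; apply: dV; rewrite oner_eq0.
pose E : R * R * 'cV[R]_3 -> R := expR \o (cst (- p2 c) * Q).
have dE : differentiable E p.
  apply: differentiable_comp; first exact: differentiableM.
  exact/derivable1_diffP/ex_derive.
have J0 := lt0r_neq0 (inertia_gt0 c).
have -> : rotor_f c =
    cst (kappa c) * N ^+ 3 * (fun q => (inertia c * W q)^-1) * (Q - cst (p1 c)) * E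
    - cst (P0 c) * (fun q => (inertia c * W q)^-1)
    - cst (kappa c) * N ^+ 3 * (fun q => (3 * inertia c * W q)^-1) * cst (p3 c)
      * E * S.
  apply/funext => q; rewrite /rotor_f /g1 /g2 /E /Q /S /N /W /dotv !fctE/= mul1r.
  rewrite mulNr mulrA; congr (_ - _ * _).
have dV1 := dV _ J0.
have dV3 : differentiable (fun q => (3 * inertia c * W q)^-1) p.
  by apply: dV; rewrite mulf_neq0// pnatr_eq0.
apply: differentiableB; first apply: differentiableB.
- apply: differentiableM => //; apply: differentiableM; last exact: differentiableB.
  by apply: differentiableM => //; apply: differentiableM => //; apply: differentiableX.
- exact: differentiableM.
- apply: differentiableM => //; apply: differentiableM => //.
  apply: differentiableM => //; apply: differentiableM => //.
  by apply: differentiableM => //; apply: differentiableX.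
Qed.

(** The partial derivatives of the model are one-variable derivatives; this
    reads them as directional derivatives of a function of the whole point. *)
Lemma derive1_lineE (V : normedModType R) (f : V -> R) (p v : V) (g : R -> R) (a : R) :
  (forall h, g (h + a) = f (h *: v + p)) -> derive1 g a = 'D_v f p.
Proof.
move=> gf; rewrite /derive1 /derive; set d := (fun _ : R => _); set d' := (fun _ : R => _).
have ga : g a = f p by rewrite -[a]add0r gf scale0r add0r.
suff -> : d = d' by []; apply/funext => h; by rewrite /d /d' gf ga.
Qed.

Lemma wpoint_basis (v : R * R * 'cV[R]_3) :
  v = v.1.1 *: (1, 0, 0) + v.1.2 *: (0, 1, 0)
      + \sum_j v.2 j 0 *: (0, 0, delta_mx j 0).
Proof.
set S := \sum_j _.
have S1 : S.1 = 0.
  by rewrite /S (raddf_sum fst) big1// => j _; rewrite /= scaler0.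
have S2 : S.2 = v.2.
  by rewrite /S (raddf_sum snd) [RHS]matrix_sum_delta exchange_big/= big_ord1.
case: v S S1 S2 => [[n w] s] S S1 S2.
have -> : S = (0, 0, s) by rewrite [LHS]surjective_pairing S1 S2.
apply: injective_projections; last by rewrite /= !scaler0 !add0r.
by apply: injective_projections; rewrite /= /GRing.scale/= !mulr0 !mulr1 ?addr0 ?add0r.
Qed.

(** Linearity of the differential. *)
Lemma derive_wpoint (f : R * R * 'cV[R]_3 -> R) (p v : R * R * 'cV[R]_3) :
  differentiable f p ->
  'D_v f p = 'D_(1, 0, 0) f p * v.1.1 + 'D_(0, 1, 0) f p * v.1.2
             + \sum_j 'D_(0, 0, delta_mx j 0) f p * v.2 j 0.
Proof.
move=> df; rewrite !deriveE//.
under eq_bigr do rewrite deriveE//.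
rewrite {1}[v]wpoint_basis !linearD !linearZ linear_sum/=.
congr (_ + _); first by rewrite mulrC [X in _ + X = _]mulrC.
by apply: eq_bigr => j _; rewrite linearZ/= mulrC.
Qed.

Lemma rho_nuE (c : rotor R) (p : wpoint R) :
  rho_nu c p = 'D_(1, 0, 0) (rotor_f c : R * R * 'cV[R]_3 -> R) p.
Proof.
apply: derive1_lineE => h; congr (rotor_f c (_, _, _)).
- by rewrite /= /GRing.scale/= mulr1.
- by rewrite /= /GRing.scale/= mulr0 add0r.
- by rewrite /= scaler0 add0r.
Qed.

Lemma rho_omE (c : rotor R) (p : wpoint R) :
  rho_om c p = 'D_(0, 1, 0) (rotor_f c : R * R * 'cV[R]_3 -> R) p.
Proof.
apply: derive1_lineE => h; congr (rotor_f c (_, _, _)).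
- by rewrite /= /GRing.scale/= mulr0 add0r.
- by rewrite /= /GRing.scale/= mulr1.
- by rewrite /= scaler0 add0r.
Qed.

Lemma rho_thE (c : rotor R) (p : wpoint R) (j : 'I_3) :
  rho_th c p j 0
  = 'D_(0, 0, delta_mx j 0) (rotor_f c : R * R * 'cV[R]_3 -> R) p.
Proof.
rewrite mxE; apply: derive1_lineE => h; congr (rotor_f c (_, _, _)).
- by rewrite /= /GRing.scale/= mulr0 add0r.
- by rewrite /= /GRing.scale/= mulr0 add0r.
- by rewrite /= addr0 addrC.
Qed.

(** The weight of [intermediate] sits on the operating point q, whereas the
    segment is run through from q to p: hence the witness 1 - t. *)
Lemma rotor_mean_value (c : rotor R) (q p : wpoint R) :
  0 < q.1.2 -> 0 < p.1.2 -> exists lam, mean_value c q p lam.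
Proof.
move=> q0 p0.
pose f : R * R * 'cV[R]_3 -> R := rotor_f c.
pose x : R * R * 'cV[R]_3 := q.
pose v : R * R * 'cV[R]_3 := (p : R * R * 'cV[R]_3) - x.
have om_gt0 (t : R) : 0 <= t <= 1 -> 0 < (x + t *: v).1.2.
  move=> /andP[t0 t1] /=.
  have -> : q.1.2 + t *: (p.1.2 - q.1.2) = (1 - t) * q.1.2 + t * p.1.2.
    by rewrite /GRing.scale/=; ring.
  have [->|tn0] := eqVneq t 0; first by rewrite subr0 mul1r mul0r addr0.
  by apply: ltr_wpDl; [rewrite mulr_ge0 ?subr_ge0// ltW|rewrite mulr_gt0// lt0r tn0].
have df t : 0 <= t <= 1 -> differentiable f (x + t *: v).
  by move=> /om_gt0 /lt0r_neq0; exact: differentiable_rotor_f.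
have [t [t01 fE]] := mean_value_segment df.
exists (1 - t); split; first lra.
have -> : intermediate q p (1 - t) = x + t *: v.
  rewrite /intermediate /x /v; apply: injective_projections.
    by apply: injective_projections; rewrite /= /GRing.scale/=; ring.
  by rewrite /= subKr scalerBl scale1r scalerBr -addrA [- _ + _]addrC.
have dfe : differentiable f (x + t *: v) by apply: df; lra.
cbv zeta; rewrite rho_nuE rho_omE.
have -> : dotv (rho_th c (x + t *: v)) (p.2 - q.2)
    = \sum_j 'D_(0, 0, delta_mx j 0) f (x + t *: v) * v.2 j 0.
  by apply: eq_bigr => j _; rewrite rho_thE.
have -> : rotor_f c p - rotor_f c q = f (x + v) - f x by rewrite /v subrKC.
rewrite fE; exact: (derive_wpoint v dfe).
Qed.

End MeanValue.

(** * The closed loop *)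

Section ClosedLoop.
Context {R : realType}.

Lemma dotvNZ n (v w : 'cV[R]_n) (a : R) : dotv v (- (a *: w)) = - (dotv v w * a).
Proof.
rewrite /dotv mulr_suml -sumrN; apply: eq_bigr => i _; rewrite !mxE; ring.
Qed.

(** The wind and speed increments from the operating point are u and the speed
    error, and the pitch increment is the control law. *)
Lemma closed_loop_displayed_form (c : rotor R) (nu0 om0 th0 thbar psi k : R)
    (rho0 : 'cV[R]_3) (z : R * R) (u lam : R) :
  let q := operating_point nu0 om0 th0 in
  let p := closed_loop_point nu0 om0 th0 thbar psi k rho0 z u in
  let eta := intermediate q p lam in
  rotor_f c q = 0 -> mean_value c q p lam ->
  (closed_loop c nu0 om0 th0 thbar psi k rho0 z u).1 =
    (rho_om c eta + psi) * speed_error psi z + rho_nu c eta * u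
    - dotv (rho_th c eta) rho0 * sat (k * z.1) (- th0) (thbar - th0).
Proof.
move=> q p eta q_eq [_]; cbv zeta; rewrite -/eta q_eq subr0 /= => pE.
rewrite /closed_loop/= -/p pE.
have -> : p.2 - q.2 = pitch_error th0 thbar k rho0 z.1.
  by rewrite addrC addKr.
by rewrite dotvNZ /=; ring.
Qed.

(** Completing the square. *)
Lemma cross_term_le (a x y c : R) : 0 < c ->
  a * (x * y) <= a ^+ 2 / (4 * c) * x ^+ 2 + c * y ^+ 2.
Proof.
move=> c0.
have -> : a ^+ 2 / (4 * c) * x ^+ 2 + c * y ^+ 2
  = (a * x / 2 - c * y) ^+ 2 / c + a * (x * y) by field; rewrite gt_eqF.
by rewrite lerDr divr_ge0 ?sqr_ge0// ltW.
Qed.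

(** The sector bound on the saturation at k * y, divided by k, is multiplied by
    rho >= phi; this is legitimate because the sector bound makes y * S
    nonnegative. *)
Lemma sat_feedback_le (mu phi k y S rho : R) : 0 < mu -> 0 < phi -> 0 < k ->
  mu * (k * y) ^+ 2 <= k * y * S -> phi <= rho ->
  mu * phi * k * y ^+ 2 <= y * (rho * S).
Proof.
move=> mu0 phi0 k0 h hrho.
have h1 : mu * k * y ^+ 2 <= y * S.
  rewrite -(ler_pM2l k0); rewrite [leRHS]mulrA.
  by apply: le_trans h; rewrite le_eqVlt; apply/orP; left; apply/eqP; ring.
have h0 : 0 <= mu * k * y ^+ 2 by rewrite mulr_ge0 ?sqr_ge0// mulr_ge0// ltW.
have h2 := le_trans h0 h1.
have -> : mu * phi * k * y ^+ 2 = phi * (mu * k * y ^+ 2) by ring.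
have -> : y * (rho * S) = rho * (y * S) by ring.
apply: (le_trans (_ : _ <= phi * (y * S))); first by rewrite ler_pM2l.
exact: ler_wpM2r.
Qed.

(** Here y is sigma, e the speed error and fb the feedback term.  The product
    x * e carries a factor psi, and psi * x = y - e: so x drops out and a
    quadratic form in y, e and u remains. *)
Lemma dissipation_inequality (psi bnu bom gamma L rnu rom y x e u fb : R) :
  0 < psi -> 0 < gamma -> 0 < bom ->
  `|rnu| <= bnu -> `|rom| <= bom ->
  1 + (bom + 2 * psi) ^+ 2 / (4 * psi) + bnu ^+ 2 / (4 * gamma ^+ 2) <= L ->
  L * y ^+ 2 <= y * fb -> e = y - psi * x ->
  y * ((rom + psi) * e + rnu * u - fb) + psi * (bom + psi + 2) * (x * e)
    <= gamma ^+ 2 * u ^+ 2 - e ^+ 2.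
Proof.
move=> psi0 gamma0 bom0 hnu hom hL hfb eE.
(* b is at once the weight of e^2 and the resulting weight of y^2, because
   (rom + psi + 1 + b)^2 <= (2 b)^2. *)
pose b := bom + psi + 1.
have b0 : 0 < b by rewrite /b; lra.
have hnu' : rnu * (y * u) <= bnu ^+ 2 / (4 * gamma ^+ 2) * y ^+ 2 + gamma ^+ 2 * u ^+ 2.
  apply: le_trans (cross_term_le rnu y u (_ : 0 < gamma ^+ 2)) _; first exact: exprn_gt0.
  rewrite lerD2r; apply: ler_wpM2r; first exact: sqr_ge0.
  apply: ler_wpM2r; first by rewrite invr_ge0 mulr_ge0 ?sqr_ge0.
  by rewrite -(@real_normK _ rnu) ?num_real// lerXn2r ?nnegrE// (le_trans _ hnu).
have hom' : (rom + psi + 1 + b) * (y * e) <= b * y ^+ 2 + b * e ^+ 2.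
  apply: le_trans (cross_term_le _ y e b0) _; rewrite lerD2r.
  apply: ler_wpM2r; first exact: sqr_ge0.
  rewrite ler_pdivrMr ?mulr_gt0//.
  have -> : b * (4 * b) = (2 * b) ^+ 2 by ring.
  by move: hom; rewrite ler_norml => /andP[h1 h2]; rewrite lerXn2r ?nnegrE// /b; lra.
have hb : b <= 1 + (bom + 2 * psi) ^+ 2 / (4 * psi).
  have -> : 1 + (bom + 2 * psi) ^+ 2 / (4 * psi) = b + bom ^+ 2 / (4 * psi).
    by rewrite /b; field; rewrite gt_eqF.
  by rewrite lerDl divr_ge0 ?sqr_ge0// mulr_ge0// ltW.
have hLy : (b + bnu ^+ 2 / (4 * gamma ^+ 2)) * y ^+ 2 <= L * y ^+ 2.
  by apply: ler_wpM2r; [exact: sqr_ge0|lra].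
have xe : psi * (bom + psi + 2) * (x * e) = (1 + b) * (y * e - e ^+ 2).
  by rewrite eE /b; ring.
rewrite xe.
have -> : y * ((rom + psi) * e + rnu * u - fb) + (1 + b) * (y * e - e ^+ 2)
  = (rom + psi + 1 + b) * (y * e) + rnu * (y * u) - y * fb - (1 + b) * e ^+ 2 by ring.
lra.
Qed.

End ClosedLoop.

(** * Squares of primitives of integrable functions *)

Section SquareOfPrimitive.
Context {R : realType}.
Notation mu := (@lebesgue_measure R).
Implicit Types (a b s t : R).

(** A bound on all short increments adds up to a bound on the whole interval,
    since the right-hand side is an increment too. *)
Lemma telescoping_increment (D K : R -> R) a b (c d : R) : 0 < d -> a <= b ->
  (forall s t, a <= s -> s <= t -> t <= b -> t - s < d ->
    `|D t - D s| <= c * (K t - K s)) ->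
  `|D b - D a| <= c * (K b - K a).
Proof.
move=> d0 ab step.
have iter n t : a <= t -> t <= b -> t - a <= (d / 2) *+ n ->
    `|D t - D a| <= c * (K t - K a).
  elim: n t => [|n IHn] t at_ tb tn.
    have -> : t = a by apply/eqP; rewrite eq_le at_ andbT -subr_le0.
    by apply: step => //; rewrite subrr.
  (* one step back by half of the admissible length, but not beyond a *)
  pose s := Num.max a (t - d / 2).
  have d20 : 0 < d / 2 by rewrite divr_gt0.
  have as_ : a <= s by rewrite le_max lexx.
  have st : s <= t by rewrite ge_max at_/= gerBl ltW.
  have ts : t - s < d.
    have : t - d / 2 <= s by rewrite le_max lexx orbT.
    lra.
  have sn : s - a <= (d / 2) *+ n.
    rewrite lerBlDr ge_max; apply/andP; split.
      by rewrite lerDr mulrn_wge0 ?ltW.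
    by move: tn; rewrite mulrS; lra.
  have := IHn s as_ (le_trans st tb) sn.
  have := step s t as_ st tb ts.
  have -> : D t - D a = (D t - D s) + (D s - D a) by ring.
  have -> : c * (K t - K a) = c * (K t - K s) + c * (K s - K a) by ring.
  by move=> h1 h2; apply: (le_trans (ler_normD _ _)); exact: lerD.
have d20 : 0 < d / 2 by rewrite divr_gt0.
apply: (iter (Num.bound ((b - a) / (d / 2)))) => //.
rewrite -mulr_natl -ler_pdivrMr//; apply/ltW/archi_boundP.
by rewrite divr_ge0 ?subr_ge0// ltW.
Qed.

Lemma sub_itvoc_itvcc a b s t : a <= s -> t <= b -> `]s, t] `<=` `[a, b].
Proof.
move=> as_ tb x /=; rewrite !in_itv/= => /andP[sx xt].
by rewrite (le_trans as_ (ltW sx)) (le_trans xt tb).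
Qed.

(** Absolute continuity of the integral; it is used as a uniform modulus of
    continuity for primitives. *)
Lemma integrable_abs_continuous a b (f : R -> R) (e : R) : 0 < e ->
  mu.-integrable `[a, b] (EFin \o f) ->
  exists2 d : R, 0 < d & forall s t, a <= s -> t <= b -> t - s < d ->
    \int[mu]_(x in `]s, t]) `|f x| < e.
Proof.
move=> e0 intf.
have intfab : mu.-integrable setT (EFin \o (f \_ `[a, b])).
  by rewrite -restrict_EFin; apply/integrable_restrict => //=; rewrite setTI.
have [d [d0 small]] := integral_normr_continuous intfab e0.
exists d => // s t as_ tb tsd.
have -> : \int[mu]_(x in `]s, t]) `|f x| = \int[mu]_(x in `]s, t]) `|(f \_ `[a, b]) x|.
  apply: eq_Rintegral => x; rewrite inE => xst.
  by rewrite patchE mem_set//; exact: sub_itvoc_itvcc xst.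
apply: small => //; rewrite [X in (X < _)%E](lebesgue_measure_itv `]s, t]) /= lte_fin.
by case: ifPn => // _; rewrite -EFinB lte_fin.
Qed.

Lemma Rintegral_increment a b s t (h : R -> R) :
  mu.-integrable `[a, b] (EFin \o h) -> a <= s -> s <= t -> t <= b ->
  \int[mu]_(x in `[a, t]) h x - \int[mu]_(x in `[a, s]) h x
  = \int[mu]_(x in `]s, t]) h x.
Proof.
move=> inth as_ st tb; apply: Rintegral_itvB; rewrite ?bnd_simp//.
by apply: integrableS inth => //; apply: subset_itvl; rewrite bnd_simp.
Qed.

Lemma primitive_continuous a b (f F : R -> R) : a <= b ->
  mu.-integrable `[a, b] (EFin \o f) ->
  (forall t, a <= t <= b -> F t = F a + \int[mu]_(x in `[a, t]) f x) ->
  {within `[a, b], continuous F}.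
Proof.
move=> ab intf FE.
apply: (@subspace_eq_continuous _ _ _ (fun t => F a + \int[mu]_(x in `[a, t]) f x)).
  by move=> t; rewrite inE/= in_itv/= => /FE.
have cP := parameterized_integral_continuous ab intf.
move=> x; apply: (@continuousD R R _ (cst (F a) : subspace `[a, b] -> R)).
  exact: cst_continuous.
exact: cP.
Qed.

Lemma integrable_continuousM a b (f F : R -> R) :
  {within `[a, b], continuous F} -> mu.-integrable `[a, b] (EFin \o f) ->
  mu.-integrable `[a, b] (EFin \o (fun x => F x * f x)).
Proof.
move=> cF intf; apply: (@integrableMr _ _ _ mu `[a, b] _ F (EFin \o f)) => //.
  exact: subspace_continuous_measurable_fun.
have [M [Mreal MP]] := compact_bounded (continuous_compact cF (@segment_compact _ a b)).
exists M; split => // N MN x xab; apply: (MP _ MN); exact: imageP.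
Qed.

(** As the right end point t varies, the difference D of the two sides is
    constant.  On a short interval from s to t, factoring
    F(t)^2 - F(s)^2 = (F(t) + F(s)) * (F(t) - F(s)) writes the increment of D
    as the integral of ((F(t) - F(x)) - (F(x) - F(s))) * f(x), which is at most
    2 e times the integral of |f| if F varies by at most e there.  These
    bounds add up to 2 e times the integral of |f| over the whole interval,
    for every e > 0. *)
Theorem sqr_primitive a b (f F : R -> R) : a <= b ->
  mu.-integrable `[a, b] (EFin \o f) ->
  (forall t, a <= t <= b -> F t = F a + \int[mu]_(x in `[a, t]) f x) ->
  F b ^+ 2 - F a ^+ 2 = 2 * \int[mu]_(x in `[a, b]) (F x * f x).
Proof.
move=> ab intf FE.
have cF := primitive_continuous ab intf FE.
have intFf := integrable_continuousM cF intf.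
have intnf : mu.-integrable `[a, b] (EFin \o (fun x => `|f x|)).
  exact: integrable_norm.
have Fincr s t : a <= s -> s <= t -> t <= b ->
    F t - F s = \int[mu]_(x in `]s, t]) f x.
  move=> as_ st tb; rewrite -(Rintegral_increment intf as_ st tb).
  rewrite FE ?(le_trans as_ st)// [F s]FE ?as_ ?(le_trans st tb)//; ring.
pose D t := F t ^+ 2 - 2 * \int[mu]_(x in `[a, t]) (F x * f x).
pose K t := \int[mu]_(x in `[a, t]) `|f x|.
have D_small e : 0 < e -> `|D b - D a| <= (2 * e) * (K b - K a).
  move=> e0; have [d d0 small] := integrable_abs_continuous e0 intf.
  have osc s t : a <= s -> s <= t -> t <= b -> t - s < d -> `|F t - F s| <= e.
    move=> as_ st tb tsd; rewrite Fincr//.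
    apply: (le_trans _ (ltW (small s t as_ tb tsd))).
    apply: le_normr_Rintegral => //.
    by apply: integrableS intf => //; exact: sub_itvoc_itvcc.
  apply: (telescoping_increment d0 ab) => s t as_ st tb tsd.
  have sub := @sub_itvoc_itvcc a b s t as_ tb.
  have ifst : mu.-integrable `]s, t] (EFin \o f) by exact: integrableS intf.
  have iFfst : mu.-integrable `]s, t] (EFin \o (fun x => F x * f x)).
    exact: integrableS intFf.
  have infst : mu.-integrable `]s, t] (EFin \o (fun x => `|f x|)).
    exact: integrableS intnf.
  have isum : mu.-integrable `]s, t] (EFin \o (fun x => (F t + F s) * f x)).
    exact: (integrableZl _ _ ifst).
  have iFf2 : mu.-integrable `]s, t] (EFin \o (fun x => 2 * (F x * f x))).
    exact: (integrableZl _ _ iFfst).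
  have -> : D t - D s = \int[mu]_(x in `]s, t]) ((F t + F s) * f x - 2 * (F x * f x)).
    rewrite RintegralB// !RintegralZl// -Fincr//.
    rewrite -(Rintegral_increment intFf as_ st tb) /D; ring.
  rewrite (Rintegral_increment intnf as_ st tb) -RintegralZl//.
  have idiff : mu.-integrable `]s, t]
      (EFin \o (fun x => (F t + F s) * f x - 2 * (F x * f x))).
    exact: (integrableB _ isum iFf2).
  apply: (le_trans (le_normr_Rintegral _ idiff)) => //.
  apply: le_Rintegral => //.
  - exact: integrable_norm.
  - exact: (integrableZl _ _ infst).
  - move=> x /=; rewrite in_itv/= => /andP[sx xt].
    have -> : (F t + F s) * f x - 2 * (F x * f x)
            = ((F t - F x) - (F x - F s)) * f x by ring.
    rewrite normrM ler_wpM2r//.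
    have h1 : `|F t - F x| <= e by apply: osc => //; lra.
    have h2 : `|F x - F s| <= e by apply: osc => //; lra.
    by apply: (le_trans (ler_normB _ _)); lra.
have K_ge0 : 0 <= K b - K a.
  rewrite (Rintegral_increment intnf) ?lexx//.
  by apply: Rintegral_ge0.
have D0 : D b - D a = 0.
  apply/eqP; rewrite -normr_le0; apply/ler_addgt0Pl => e e0; rewrite addr0.
  (* K b - K a may vanish, hence the + 1 *)
  have M0 : 0 < 2 * (K b - K a + 1) by lra.
  apply: (le_trans (D_small (e / (2 * (K b - K a + 1))) _)); first exact: divr_gt0.
  have -> : 2 * (e / (2 * (K b - K a + 1))) * (K b - K a)
     = e * ((K b - K a) / (K b - K a + 1)) by field; lra.
  rewrite ler_piMr ?(ltW e0)// ler_pdivrMr; lra.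
have Ia : \int[mu]_(x in `[a, a]) (F x * f x) = 0.
  by rewrite set_itv1 Rintegral_set1.
by move: D0; rewrite /D Ia; lra.
Qed.

End SquareOfPrimitive.

(** * Integration along motions *)

Section Motions.
Context {R : realType}.
Notation mu := (@lebesgue_measure R).

(** The difference g - f coincides almost everywhere with its absolute value. *)
Lemma ae_le_Rintegral (A : set R) (f g : R -> R) : measurable A ->
  mu.-integrable A (EFin \o f) -> mu.-integrable A (EFin \o g) ->
  {ae mu, forall x, A x -> f x <= g x} ->
  \int[mu]_(x in A) f x <= \int[mu]_(x in A) g x.
Proof.
move=> mA intf intg fg; rewrite -subr_ge0 -RintegralB//.
have intgf : mu.-integrable A (EFin \o (fun x => g x - f x)).
  exact: (integrableB _ intg intf).
have -> : \int[mu]_(x in A) (g x - f x) = \int[mu]_(x in A) `|g x - f x|.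
  congr fine; apply: ae_eq_integral => //.
  - exact: measurable_int intgf.
  - by apply: measurable_int; exact: (integrable_norm intgf).
  - apply: (@filterS _ _ (ae_filter_ringOfSetsType mu) _ _ _ fg) => x fgx Ax.
    by rewrite ger0_norm// subr_ge0 fgx.
exact: Rintegral_ge0.
Qed.

(** Truncation at b + 1 rather than b, because truncated functions vanish at the
    horizon itself. *)
Lemma L2e_sqr_integrable (u : R -> R) (a b : R) : 0 <= a -> 0 <= b -> L2e u ->
  mu.-integrable `[a, b] (EFin \o (fun s => u s ^+ 2)).
Proof.
move=> a0 b0 [_ /(_ (b + 1))].
have b1 : 0 <= b + 1 by rewrite addr_ge0.
move=> /(_ b1) intu.
have sub : `[a, b] `<=` (`[0, +oo[%classic : set R).
  by apply: subset_itv; rewrite bnd_simp.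
have {}intu : mu.-integrable `[a, b] (fun t => ((u \_ `[0, b + 1[) t ^+ 2)%:E).
  exact: integrableS intu.
apply: eq_integrable intu => //.
move=> x; rewrite inE/= in_itv/= => /andP[ax xb].
rewrite patchE mem_set//= in_itv/= (le_trans a0 ax)/=.
by apply: le_lt_trans xb _; rewrite ltrDl.
Qed.

Lemma continuous_sqr_integrable (a b : R) (f : R -> R) :
  {within `[a, b], continuous f} ->
  mu.-integrable `[a, b] (EFin \o (fun s => f s ^+ 2)).
Proof.
move=> cf; apply: continuous_compact_integrable; first exact: segment_compact.
move=> x; apply: (@continuous_comp _ _ _ (f : subspace _ -> R) (fun y => y ^+ 2)).
  exact: cf.
exact: exprn_continuous.
Qed.

End Motions.

Unset Implicit Arguments.
Set Strict Implicit.

Theorem theorem1 (R : realType) (c : rotor R)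
    (nu0 om0 th0 thbar : R)
    (h_om0 : 0 < om0)
    (h_th0 : 0 <= th0 <= thbar)
    (h_eq : rotor_f c (operating_point nu0 om0 th0) = 0)
    (psi : R) (h_psi : 0 < psi)
    (D : set (wpoint R)) (hD : D `<=` rotor_domain thbar)
    (bnu bom phi : R) (h_bnu : 0 < bnu) (h_bom : 0 < bom) (h_phi : 0 < phi)
    (rho0 : 'cV[R]_3)
    (h_bounds : coefficient_bounds c (operating_point nu0 om0 th0) D
                  bnu bom phi rho0)
    (r mu : R) (h_r : 0 < r) (h_mu : 0 < mu)
    (h_sat : forall y : R, `|y| <= r ->
       mu * y ^+ 2 <= y * sat y (- th0) (thbar - th0))
    (gamma : R) (h_gamma : 0 < gamma)
    (k : R) (h_k : 0 < k)
    (h_gain : (mu * phi)^-1 *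
        (1 + (bom + 2 * psi) ^+ 2 / (4 * psi) + bnu ^+ 2 / (4 * gamma ^+ 2))
        <= k) :
  (* the closed-loop error dynamics has the displayed form *)
  (forall (sigma x u : R),
     D (closed_loop_point nu0 om0 th0 thbar psi k rho0 (sigma, x) u) ->
     exists lam : R,
       let eta := intermediate (operating_point nu0 om0 th0)
         (closed_loop_point nu0 om0 th0 thbar psi k rho0 (sigma, x) u) lam in
       0 < lam < 1 /\
       closed_loop c nu0 om0 th0 thbar psi k rho0 (sigma, x) u =
         ((rho_om c eta + psi) * (sigma - psi * x) + rho_nu c eta * u
            - dotv (rho_th c eta) rho0
              * sat (k * sigma) (- th0) (thbar - th0),
          sigma - psi * x)) /\
  (* and it is finite-gain stable from the wind error to the speed error *)
  dissipative_on (closed_loop_region D r nu0 om0 th0 thbar psi k rho0)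
    (closed_loop c nu0 om0 th0 thbar psi k rho0)
    (speed_error psi) gamma.
Proof.
have mvt z u : D (closed_loop_point nu0 om0 th0 thbar psi k rho0 z u) ->
    exists lam, mean_value c (operating_point nu0 om0 th0)
      (closed_loop_point nu0 om0 th0 thbar psi k rho0 z u) lam.
  by move=> /hD[om_gt0 _]; exact: rotor_mean_value.
split.
  move=> sigma x u /mvt[lam lamP]; exists lam => eta; split; first exact: lamP.1.
  by apply: injective_projections; first exact: closed_loop_displayed_form.
pose g := closed_loop c nu0 om0 th0 thbar psi k rho0.
pose a := psi * (bom + psi + 2).
have a_ge0 : 0 <= a by rewrite /a mulr_ge0; lra.
exists (fun z => z.1 ^+ 2 / 2 + a * (z.2 ^+ 2 / 2)); split.
  move=> z; apply: addr_ge0; [|apply: mulr_ge0 => //].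
    by apply: divr_ge0 => //; exact: sqr_ge0.
  by apply: divr_ge0 => //; exact: sqr_ge0.
have decay z u : closed_loop_region D r nu0 om0 th0 thbar psi k rho0 z u ->
    z.1 * (g z u).1 + a * (z.2 * (g z u).2)
      <= gamma ^+ 2 * u ^+ 2 - speed_error psi z ^+ 2.
  case=> Dz kz; have [lam lamP] := mvt z u Dz.
  have [hnu hom hth] := h_bounds _ _ Dz lamP.
  rewrite /g (closed_loop_displayed_form h_eq lamP).
  apply: (dissipation_inequality (bnu := bnu) (L := mu * phi * k)) => //.
  - by rewrite -ler_pdivrMl// mulr_gt0.
  - by apply: sat_feedback_le => //; exact: h_sat.
move=> u z t0 t1 t0_ge0 t01 u2 [intg1 intg2 z1E z2E] inX.
have c1 := primitive_continuous t01 intg1 z1E.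
have c2 := primitive_continuous t01 intg2 z2E.
have ce : {within `[t0, t1], continuous (fun s => speed_error psi (z s))}.
  pose w1 : subspace `[t0, t1] -> R := fun s => (z s).1.
  pose w2 : subspace `[t0, t1] -> R := fun s => (z s).2.
  move=> s; apply: (@continuousB R R _ w1 (cst psi * w2)); first exact: c1.
  by apply: (@continuousM R _ (cst psi) w2); [exact: cst_continuous|exact: c2].
have int_supply : lebesgue_measure.-integrable `[t0, t1]
    (EFin \o (fun s => gamma ^+ 2 * u s ^+ 2 - speed_error psi (z s) ^+ 2)).
  have intu := L2e_sqr_integrable t0_ge0 (le_trans t0_ge0 t01) u2.
  have intgu : lebesgue_measure.-integrable `[t0, t1]
      (EFin \o (fun s => gamma ^+ 2 * u s ^+ 2)).
    exact: (integrableZl _ _ intu).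
  exact: (integrableB _ intgu (continuous_sqr_integrable ce)).
have int1 := integrable_continuousM c1 intg1.
have int2 := integrable_continuousM c2 intg2.
have int2a : lebesgue_measure.-integrable `[t0, t1]
    (EFin \o (fun s => a * ((z s).2 * (g (z s) (u s)).2))).
  exact: (integrableZl _ _ int2).
have int_power : lebesgue_measure.-integrable `[t0, t1]
    (EFin \o (fun s => (z s).1 * (g (z s) (u s)).1 + a * ((z s).2 * (g (z s) (u s)).2))).
  exact: (integrableD _ int1 int2a).
have power_le : Rintegral lebesgue_measure `[t0, t1]
      (fun s => (z s).1 * (g (z s) (u s)).1 + a * ((z s).2 * (g (z s) (u s)).2))
    <= Rintegral lebesgue_measure `[t0, t1]
      (fun s => gamma ^+ 2 * u s ^+ 2 - speed_error psi (z s) ^+ 2).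
  apply: ae_le_Rintegral => //.
  apply: (@filterS _ _ (ae_filter_ringOfSetsType lebesgue_measure) _ _ _ inX) => s inXs.
  rewrite /= in_itv/= => /inXs.
  exact: decay.
have sq1 : (z t1).1 ^+ 2 - (z t0).1 ^+ 2
    = 2 * Rintegral lebesgue_measure `[t0, t1] (fun s => (z s).1 * (g (z s) (u s)).1).
  exact: sqr_primitive t01 intg1 z1E.
have sq2 : (z t1).2 ^+ 2 - (z t0).2 ^+ 2
    = 2 * Rintegral lebesgue_measure `[t0, t1] (fun s => (z s).2 * (g (z s) (u s)).2).
  exact: sqr_primitive t01 intg2 z2E.
apply: le_trans (lerD (lexx _) power_le).
rewrite RintegralD// RintegralZl// le_eqVlt; apply/orP; left; apply/eqP.
by move: sq1 sq2; set I1 := Rintegral _ _ _; set I2 := Rintegral _ _ _; nra.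
Qed.
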